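(* Let $n\ge 2$, let $X=(X_1,\dots,X_n)$ be a vector of i.i.d. real random variables with finite common standard deviation $\sigma$, and let $\Pi$ be a uniformly random permutation of $\{1,\dots,n\}$ independent of $X$. Let $$T(X,\Pi)=\frac{1}{d_2}\cdot\frac{1}{n-1}\sum_{t=2}^{n}\bigl|X_{\Pi(t)}-X_{\Pi(t-1)}\bigr|,\qquad d_2=\frac{2}{\sqrt{\pi}}.$$ Then $$\mathrm{Var}\bigl\{T(X,\Pi)\bigr\}=\mathbb{E}\Bigl[\mathrm{Var}\bigl\{T(X,\Pi)\mid X\bigr\}\Bigr]+\mathrm{Var}\Bigl[\mathbb{E}\bigl\{T(X,\Pi)\mid X\bigr\}\Bigr].$$
   Context: Here $\mathbb{E}\{\cdot\mid X\}$ and $\mathrm{Var}\{\cdot\mid X\}$ denote the conditional expectation and conditional variance given $X$, i.e. over the uniformly random permutation $\Pi$ with the values $X$ held fixed. The symbol $\pi$ in $d_2=2/\sqrt{\pi}$ is the circle constant. *)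

(* Defs.v *)
From HB Require Import structures.
From mathcomp Require Import all_boot all_order all_algebra all_fingroup.
From mathcomp Require Import all_classical all_reals all_analysis.
From mathcomp Require Import measurable_realfun.

Set Implicit Arguments.
Unset Strict Implicit.
Unset Printing Implicit Defensive.

Import Order.TTheory GRing.Theory Num.Theory.
Import numFieldNormedType.Exports.

Local Open Scope classical_set_scope.
Local Open Scope ring_scope.

HB.instance Definition _ (I : finType) :=
  isPointed.Build (perm_type I) (1%g : {perm I}).
HB.instance Definition _ (I : finType) :=
  @isMeasurable.Build default_measure_display (perm_type I) discrete_measurable
    discrete_measurable0 discrete_measurableC discrete_measurableU.

Definition mutually_independent (d : measure_display) (Omega : measurableType d)
    (R : realType) (P : probability Omega R) (I : finType)
    (X : I -> Omega -> R) : Prop :=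
  forall (J : {set I}) (A : I -> set R), (forall i, measurable (A i)) ->
    P (\bigcap_(i in [set` J]) (X i @^-1` A i)) =
    (\prod_(i in J) P (X i @^-1` A i))%E.

Definition identically_distributed (d : measure_display)
    (Omega : measurableType d) (R : realType) (P : probability Omega R)
    (I : finType) (X : I -> Omega -> R) : Prop :=
  forall (i j : I) (A : set R), measurable A ->
    P (X i @^-1` A) = P (X j @^-1` A).

Definition independent (d dU dS : measure_display) (Omega : measurableType d)
    (U : measurableType dU) (S : measurableType dS) (R : realType)
    (P : probability Omega R) (X : Omega -> U) (Y : Omega -> S) : Prop :=
  forall (A : set U) (B : set S), measurable A -> measurable B ->
    P (X @^-1` A `&` Y @^-1` B) = (P (X @^-1` A) * P (Y @^-1` B))%E.

Definition uniform_permutation (d : measure_display) (Omega : measurableType d)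
    (R : realType) (P : probability Omega R) (n : nat)
    (Pi : {RV P >-> {perm 'I_n}}) : Prop :=
  forall s : {perm 'I_n}, P (Pi @^-1` [set s]) = (n`!%:R^-1)%:E.

(* For independent X and Y, E{f(X,Y) | X} and Var{f(X,Y) | X} are the
   expectation and the variance over the law of Y with the value of X held
   fixed. The lemmas below check these against the measure-theoretic
   definition. *)
Definition cond_expectation (d dU dS : measure_display)
    (Omega : measurableType d) (U : measurableType dU) (S : measurableType dS)
    (R : realType) (P : probability Omega R) (X : {RV P >-> U})
    (Y : {RV P >-> S}) (f : U -> S -> R) : Omega -> R :=
  fun w => fine ('E_(distribution P Y)[f (X w)])%E.

Definition cond_variance (d dU dS : measure_display)
    (Omega : measurableType d) (U : measurableType dU) (S : measurableType dS)
    (R : realType) (P : probability Omega R) (X : {RV P >-> U})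
    (Y : {RV P >-> S}) (f : U -> S -> R) : Omega -> R :=
  fun w => fine ('V_(distribution P Y)[f (X w)])%E.

(* C is a version of E{Z | sigma(X)}. *)
Definition is_cond_expectation (d dU : measure_display)
    (Omega : measurableType d) (U : measurableType dU) (R : realType)
    (P : probability Omega R) (X : Omega -> U) (Z C : Omega -> R) : Prop :=
  [/\ P.-integrable [set: Omega] (EFin \o C),
      (forall B : set R, measurable B ->
        exists2 A : set U, measurable A & C @^-1` B = X @^-1` A)
    & forall A : set U, measurable A ->
        (\int[P]_(w in X @^-1` A) (C w)%:E =
         \int[P]_(w in X @^-1` A) (Z w)%:E)%E].

Section cond_expectation_version.
Context (d dU dS : measure_display) (Omega : measurableType d)
  (U : measurableType dU) (S : measurableType dS) (R : realType).
Context (P : probability Omega R) (X : {RV P >-> U}) (Y : {RV P >-> S}).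
Context (XY : independent P X Y).

Let US : measurableType _ := (U * S)%type.

Let mXY : measurable_fun [set: Omega] (fun w => (X w, Y w)).
Proof. exact: measurable_fun_pair. Qed.

Let XYf := mfun_Sub (mem_set mXY : (fun w => (X w, Y w)) \in mfun).

Let law_XY (A : set (U * S)) : measurable A ->
  (distribution P X \x distribution P Y)%E A = distribution P XYf A.
Proof.
by move=> mA; apply: product_measure_unique => // B C mB mC; exact: XY.
Qed.

Let integrable_law (f : U -> S -> R) :
  measurable_fun setT (fun z : US => f z.1 z.2) ->
  P.-integrable [set: Omega] (fun w => (f (X w) (Y w))%:E) ->
  (distribution P X \x distribution P Y)%E.-integrable setT
    (fun z : US => (f z.1 z.2)%:E).
Proof.
move=> mf intf.
have mF : measurable_fun setT (fun z : US => (f z.1 z.2)%:E).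
  exact/measurable_EFinP.
apply/integrableP; split => //.
have /integrableP[_] : (distribution P XYf).-integrable setT
    (fun z : US => (f z.1 z.2)%:E).
  exact: integrable_pushforward.
apply: le_lt_trans.
by rewrite le_eqVlt (eq_measure_integral (distribution P XYf)) ?eqxx// =>
  A mA _; exact: law_XY.
Qed.

Lemma cond_expectationP (f : U -> S -> R) :
  measurable_fun setT (fun z => f z.1 z.2) ->
  P.-integrable [set: Omega] (fun w => (f (X w) (Y w))%:E) ->
  is_cond_expectation P X (fun w => f (X w) (Y w)) (cond_expectation X Y f).
Proof.
move=> mf intf.
pose F (z : US) := (f z.1 z.2)%:E.
have intF := integrable_law mf intf.
have mF : measurable_fun setT F by exact: measurable_int intF.
pose G := fubini_F (distribution P Y) F.
have intG : (distribution P X).-integrable [set: U] G.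
  exact: integrable_fubini_F.
have mG : measurable_fun [set: U] G by exact: measurable_int intG.
have intGX : P.-integrable [set: Omega] (G \o X).
  apply/integrableP; split; first exact: measurableT_comp.
  move/integrableP : intG => [_]; apply: le_lt_trans.
  by rewrite ge0_integral_distribution//; exact: measurableT_comp.
have mfG : measurable_fun [set: U] (fine \o G).
  by apply: measurableT_comp => //; exact: fine_measurable.
have CE : cond_expectation X Y f = (fine \o G) \o X.
  by apply/funext => w; rewrite /cond_expectation unlock.
have mCE : measurable_fun [set: Omega] (EFin \o ((fine \o G) \o X)).
  by apply/measurable_EFinP; exact: measurableT_comp.
rewrite /is_cond_expectation CE; split.
- apply: (le_integrable measurableT mCE _ intGX) => w _ /=.
  by case: (G (X w)) => [r| |] //=; rewrite normr0 leey.
- move=> B mB; exists ((fine \o G) @^-1` B) => //.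
  by rewrite -[X in measurable X]setTI; exact: mfG.
- move=> A mA.
  have mAS : measurable (A `*` setT : set US) by exact: measurableX.
  have mXA : measurable (X @^-1` A) by exact: measurable_funPTI.
  transitivity (\int[P]_(w in X @^-1` A) (G \o X) w)%E.
    apply: ae_eq_integral => //.
    + exact: measurable_funTS.
    + by apply: measurable_funTS; exact: measurableT_comp.
    + have := integrable_ae measurableT intGX.
      by apply: filterS => w /(_ I) Gfin _ /=; rewrite fineK.
  transitivity (\int[distribution P X]_(x in A) G x)%E.
    rewrite [RHS]integral_pushforward//.
    exact: integrableS intGX.
  transitivity (\int[distribution P XYf]_(z in A `*` setT) F z)%E.
    rewrite [RHS](eq_measure_integral (distribution P X \x distribution P Y)%E).
      rewrite [RHS]integral_mkcond -integral12_prod_meas1.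
        rewrite [LHS]integral_mkcond; apply: eq_integral => x _.
        rewrite /fubini_F patchE; case: ifPn => xA.
          apply: eq_integral => y _; rewrite patchE mem_set//.
          by split => //; exact: set_mem.
        rewrite integral0_eq// => y _; rewrite patchE memNset//.
        by move=> [/= /mem_set]; rewrite (negbTE xA).
      apply/(integrable_mkcond _ mAS).
      by apply: (integrableS measurableT _ _ intF) => //; exact: mAS.
    by move=> B mB _; rewrite /= -law_XY.
  rewrite [LHS]integral_pushforward//.
  + by congr integral; apply/seteqP; split => w //= [].
  + apply: integrableS intf => //.
    by rewrite -[X in measurable X]setTI; apply: mXY => //; exact: mAS.
Qed.

Lemma cond_varianceP (f : U -> S -> R) :
  measurable_fun setT (fun z => f z.1 z.2) ->
  P.-integrable [set: Omega] (fun w => (f (X w) (Y w))%:E) ->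
  P.-integrable [set: Omega] (fun w =>
    ((f (X w) (Y w) - cond_expectation X Y f w) ^+ 2)%:E) ->
  is_cond_expectation P X
    (fun w => (f (X w) (Y w) - cond_expectation X Y f w) ^+ 2)
    (cond_variance X Y f).
Proof.
move=> mf intf intf2.
pose m x := fine ('E_(distribution P Y)[f x])%E.
pose g x y := (f x y - m x) ^+ 2.
suff mg : measurable_fun setT (fun z => g z.1 z.2).
  have -> : cond_variance X Y f = cond_expectation X Y g.
    by apply/funext => w; rewrite /cond_variance /variance unlock.
  exact: cond_expectationP.
have mm : measurable_fun [set: U] m.
  rewrite /m unlock; apply: measurableT_comp; first exact: fine_measurable.
  exact: measurable_fubini_F (integrable_law mf intf).
apply: measurable_funX; apply: measurable_funB => //.
exact: (measurableT_comp mm).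
Qed.

End cond_expectation_version.

(* With 0-based indices the sum ranges over 1 <= t <= n - 1. The condition
   [0 < t] also discards the cyclic wrap-around of [ord_pred]. *)
Definition moving_range_stat (R : realType) (n : nat) (x : n.-tuple R)
    (s : {perm 'I_n}) : R :=
  let d2 : R := 2 / Num.sqrt pi in
  d2^-1 * (n%:R - 1)^-1 *
    \sum_(t < n | (0 < t)%N) `|tnth x (s t) - tnth x (s (ord_pred t))|.

(* Main.v *)
(** The law of total variance holds for every square-integrable f(X, Y) with X
    and Y independent: E{f | X} and E{f^2 | X} are integrals over the law of Y,
    and averaging Var{f | X} = E{f^2 | X} - E{f | X}^2 over X leaves
    E[f^2] - E[E{f | X}^2]. The statistic is square-integrable because it is
    dominated by a multiple of |X_1| + ... + |X_n|, uniformly in the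
    permutation. *)
Require Import Defs.
From HB Require Import structures.
From mathcomp Require Import all_boot all_order all_algebra all_fingroup.
From mathcomp Require Import all_classical all_reals all_analysis.
From mathcomp Require Import measurable_realfun.

Set Implicit Arguments.
Unset Strict Implicit.
Unset Printing Implicit Defensive.

Import Order.TTheory GRing.Theory Num.Theory.
Import numFieldNormedType.Exports.

Local Open Scope classical_set_scope.
Local Open Scope ring_scope.

Lemma measurable_Lfun (d : measure_display) (T : measurableType d)
    (R : realType) (mu : {measure set T -> \bar R}) (p : \bar R) (f : T -> R) :
  f \in Lfun mu p -> measurable_fun [set: T] f.
Proof. by rewrite inE => /andP[]; rewrite inE. Qed.

Lemma integrable_sqr_Lfun2 (d : measure_display) (T : measurableType d)
    (R : realType) (mu : {measure set T -> \bar R}) (f : T -> R) :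
  measurable_fun [set: T] f ->
  mu.-integrable [set: T] (fun x => (f x ^+ 2)%:E) -> f \in Lfun mu 2%:E.
Proof.
move=> mf /integrableP[_ f2y].
rewrite inE; apply/andP; split; rewrite inE//= /finite_norm unlock.
apply: poweR_lty; apply: le_lt_trans f2y.
rewrite le_eqVlt; apply/orP; left; apply/eqP.
by apply: eq_integral => x _ /=; rewrite powR_mulrn// normrX.
Qed.

Lemma dominated_Lfun2 (d : measure_display) (T : measurableType d)
    (R : realType) (mu : {measure set T -> \bar R}) (f g : T -> R) :
  measurable_fun [set: T] f -> (forall x, `|f x| <= g x) ->
  g \in Lfun mu 2%:E -> f \in Lfun mu 2%:E.
Proof.
move=> mf fg g2; apply: integrable_sqr_Lfun2 => //.
apply: (le_integrable measurableT _ _ (Lfun2_integrable_sqr g2)) => [|x _ /=].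
  by apply/measurable_EFinP; exact: measurable_funX.
rewrite lee_fin !normrX ler_pXn2r ?nnegrE ?normr_ge0//.
exact: le_trans (fg x) (ler_norm _).
Qed.

Lemma normr_Lfun2 (d : measure_display) (T : measurableType d)
    (R : realType) (mu : {measure set T -> \bar R}) (f : T -> R) :
  f \in Lfun mu 2%:E -> (fun x => `|f x|) \in Lfun mu 2%:E.
Proof.
move=> f2; have mf := measurable_Lfun f2.
apply: integrable_sqr_Lfun2; first exact: measurableT_comp.
have -> : (fun x => (`|f x| ^+ 2)%:E) = (EFin \o (fun x => f x ^+ 2)).
  by apply/funext => x /=; rewrite real_normK ?num_real.
exact: Lfun2_integrable_sqr.
Qed.

(** Finite variance says that [f] minus a constant is square-integrable, and adding a constant back
    preserves this on a probability space. *)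
Lemma variance_lty_Lfun2 (d : measure_display) (T : measurableType d)
    (R : realType) (P : probability T R) (f : T -> R) :
  measurable_fun [set: T] f -> ('V_P[f] < +oo)%E -> f \in Lfun P 2%:E.
Proof.
(* As a value of [fine], [c] is a real number even before the mean of [f] is known to be finite. *)
move=> mf; rewrite /variance !unlock; set c := fine _ => Vy.
have mg : measurable_fun [set: T] (fun x => f x - c).
  exact: measurable_funB.
suff g2 : (fun x => f x - c) \in Lfun P 2%:E.
  have -> : f = (fun x => f x - c) + cst c.
    by apply/funext => x /=; rewrite fctE subrK.
  by apply: rpredD => //= [|?]; [exact: lee1n|exact: Lfun_cst].
apply: integrable_sqr_Lfun2 => //.
apply/integrableP; split.
  by apply/measurable_EFinP; exact: measurable_funX.
apply: le_lt_trans Vy; rewrite le_eqVlt; apply/orP; left; apply/eqP.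
by apply: eq_integral => x _; rewrite gee0_abs ?lee_fin ?sqr_ge0.
Qed.

(** Square-integrability of each section [f x] makes Var{f | X} = E{f^2 | X} - E{f | X}^2 hold at
    every outcome, not just almost everywhere. *)
Lemma law_of_total_variance (d dU dS : measure_display)
    (Omega : measurableType d) (U : measurableType dU) (S : measurableType dS)
    (R : realType) (P : probability Omega R) (X : {RV P >-> U})
    (Y : {RV P >-> S}) (f : U -> S -> R) :
  independent P X Y ->
  measurable_fun setT (fun z : U * S => f z.1 z.2) ->
  (fun w => f (X w) (Y w)) \in Lfun P 2%:E ->
  (forall x, f x \in Lfun (distribution P Y) 2%:E) ->
  ('V_P[fun w => f (X w) (Y w)] =
   'E_P[cond_variance X Y f] + 'V_P[cond_expectation X Y f])%E.
Proof.
move=> XY mf f2 fx2.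
set T := fun w => f (X w) (Y w); set M := cond_expectation X Y f.
pose M2 := cond_expectation X Y (fun x y => f x y ^+ 2).
have T1 : T \in Lfun P 1 by rewrite Lfun_subset12 ?fin_num_measure.
have [intM _ ETM] := cond_expectationP XY mf (proj1 (Lfun1_integrable _ _) T1).
have [intM2 _ ETM2] : is_cond_expectation P X (fun w => T w ^+ 2) M2.
  apply: (cond_expectationP XY (f := fun x y => f x y ^+ 2)).
    exact: measurable_funX.
  exact: Lfun2_integrable_sqr f2.
(* Tower property: the defining identity of a conditional expectation, taken over the whole
   space. *)
have ET : ('E_P[T] = 'E_P[M])%E.
  by rewrite unlock; have := ETM setT measurableT; rewrite preimage_setT.
have ET2 : ('E_P[T ^+ 2] = 'E_P[M2])%E.
  by rewrite unlock; have := ETM2 setT measurableT; rewrite preimage_setT.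
have VE w : cond_variance X Y f w = M2 w - M w ^+ 2.
  rewrite /cond_variance varianceE// fineB.
  - rewrite -[(_ ^+ 2)%E]/(_ * _)%E fineM ?expectation_fin_num//.
    by rewrite Lfun_subset12 ?fin_num_measure.
  - by rewrite Lfun_subset12 ?fin_num_measure.
  - by rewrite expectation_fin_num// Lfun2_mul_Lfun1.
  - by rewrite fin_numX// expectation_fin_num// Lfun_subset12 ?fin_num_measure.
(* Conditional Jensen inequality, from nonnegativity of the conditional variance; it puts [M] in L^2
   because [M2] is integrable. *)
have MM2 w : M w ^+ 2 <= M2 w.
  by rewrite -subr_ge0 -VE; apply: fine_ge0; exact: variance_ge0.
have mM : measurable_fun setT M.
  by apply/measurable_EFinP; exact: measurable_int intM.
have M22 : M \in Lfun P 2%:E.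
  apply: integrable_sqr_Lfun2 => //.
  apply: (le_integrable measurableT _ _ intM2) => [|w _ /=].
    by apply/measurable_EFinP; exact: measurable_funX.
  by rewrite lee_fin ger0_norm ?sqr_ge0// (le_trans (MM2 w))// ler_norm.
have -> : cond_variance X Y f = M2 \- M ^+ 2.
  by apply/funext => w; rewrite VE.
have M2L : M2 \in Lfun P 1 by exact/Lfun1_integrable.
have MML : M ^+ 2 \in Lfun P 1 by exact: Lfun2_mul_Lfun1.
(* The two occurrences of E[M^2] cancel; in the extended reals this requires E[M^2] to be finite. *)
rewrite !varianceE// expectationB// ET ET2 addeA subeK//.
exact: expectation_fin_num.
Qed.

Lemma moving_range_stat_le (R : realType) (n : nat) :
  exists C : R, forall (x : n.-tuple R) (s : {perm 'I_n}),
    `|moving_range_stat x s| <= C * \sum_(i < n) `|tnth x i|.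
Proof.
pose c : R := `|(2 / Num.sqrt pi)^-1 * (n%:R - 1)^-1|.
(* At most [n] increments occur, each bounded by [2 * N]; [c] is the absolute value of the
   normalising factor. *)
exists (c * (2 * n%:R)) => x s.
set N := \sum_(i < n) _.
have xN i : `|tnth x i| <= N by rewrite /N (bigD1 i)//= lerDl sumr_ge0.
rewrite /moving_range_stat normrM -/c -mulrA ler_wpM2l ?normr_ge0//.
rewrite ger0_norm ?sumr_ge0//.
apply: (@le_trans _ _ (\sum_(t < n) 2 * N)).
  rewrite big_mkcond ler_sum// => t _; case: ifP => _.
    by rewrite (le_trans (ler_normB _ _))// mulr_natl mulr2n lerD.
  by rewrite mulr_ge0// sumr_ge0.
by rewrite sumr_const card_ord -[_ *+ n]mulr_natr mulrAC.
Qed.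

(** Permutations carry the discrete sigma-algebra, in which every set is measurable. *)
Lemma measurable_perm (d : measure_display) (T : measurableType d) (I : finType)
    (g : {perm I} -> T) : measurable_fun setT g.
Proof. by []. Qed.

Lemma measurable_moving_range_stat (R : realType) (n : nat) :
  measurable_fun setT
    (fun z : n.-tuple R * {perm 'I_n} => moving_range_stat z.1 z.2).
Proof.
have mX (g : {perm 'I_n} -> 'I_n) : measurable_fun setT
    (fun z : n.-tuple R * {perm 'I_n} => tnth z.1 (g z.2)).
  (* The index [g z.2] varies with the permutation, so the coordinate is split into a finite sum of
     indicators times fixed coordinates, each measurable. *)
  have -> : (fun z : n.-tuple R * {perm 'I_n} => tnth z.1 (g z.2)) =
      (fun z => \sum_(i < n) (g z.2 == i)%:R * tnth z.1 i).
    apply/funext => z; rewrite (bigD1 (g z.2))//= eqxx mul1r big1 ?addr0// => i.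
    by rewrite eq_sym => /negPf ->; rewrite mul0r.
  apply: measurable_sum => i; apply: measurable_funM.
    exact: (measurableT_comp (measurable_perm (fun s => (g s == i)%:R : R))
      measurable_snd).
  exact: (measurableT_comp (measurable_tnth i) measurable_fst).
rewrite /moving_range_stat; apply: measurable_funM => //.
under eq_fun do rewrite big_mkcond.
apply: measurable_sum => t; case: (0 < t)%N => //.
apply: measurableT_comp => //; apply: measurable_funB.
  exact: (mX (fun s => s t)).
exact: (mX (fun s => s (ord_pred t))).
Qed.

Theorem proposition1 (R : realType) (d : measure_display)
    (Omega : measurableType d) (P : probability Omega R) (n : nat)
    (X : {RV P >-> n.-tuple R}) (Pi : {RV P >-> {perm 'I_n}}) (sigma : R) :
  (2 <= n)%N ->
  mutually_independent P (fun (i : 'I_n) w => tnth (X w) i) ->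
  identically_distributed P (fun (i : 'I_n) w => tnth (X w) i) ->
  0 <= sigma ->
  (forall i : 'I_n, 'V_P[fun w => tnth (X w) i] = (sigma ^+ 2)%:E) ->
  uniform_permutation Pi ->
  independent P X Pi ->
  ('V_P[fun w => moving_range_stat (X w) (Pi w)] =
   'E_P[cond_variance X Pi (@moving_range_stat R n)] +
   'V_P[cond_expectation X Pi (@moving_range_stat R n)])%E.
Proof.
move=> _ _ _ _ VX _ indep.
have [C stat_le] := moving_range_stat_le R n.
(* This is where the finite standard deviation enters. *)
have X2 i : (fun w => tnth (X w) i) \in Lfun P 2%:E.
  apply: variance_lty_Lfun2; last by rewrite VX ltry.
  exact: (measurableT_comp (measurable_tnth i)).
apply: law_of_total_variance => //.
- exact: measurable_moving_range_stat.
- apply: (@dominated_Lfun2 _ _ _ _ _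
    (C \o* (fun w => \sum_(i < n) `|tnth (X w) i|))).
  + apply: (measurableT_comp (@measurable_moving_range_stat R n)
      (g := fun w => (X w, Pi w))).
    exact: measurable_fun_pair.
  + by move=> w /=; rewrite mulrC.
  + rewrite Lfun_scale ?ler1n//.
    have -> : (fun w => \sum_(i < n) `|tnth (X w) i|) =
        \sum_(i < n) (fun w => `|tnth (X w) i|).
      by apply/funext => w; rewrite fct_sumE.
    by apply: rpred_sum => [|? i _]; [exact: lee1n|exact: normr_Lfun2].
(* With [x] fixed the bound no longer depends on the permutation, so it is a constant under the law
   of [Pi]. *)
- move=> x; apply: dominated_Lfun2 (stat_le x) _; last exact: Lfun_cst.
  exact: measurable_perm.
Qed.
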